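(* Let $p$ be a prime, let $q=p^e$, and let $A\in X\overline{\mathbb F}_p[[X]]$ be a rational series all of whose coefficients lie in the finite field $\mathbb F_q\subset\overline{\mathbb F}_p$. Then $$\|\exp_!(A)\|\le p^{q^{\|A\|}}\quad\text{and}\quad \|\log_!(1+A)\|\le 1+\|1+A\|^p.$$
   Context: For a rational series $C\in\overline{\mathbb F}_p[[X]]$ written as a reduced fraction $f/g$ with $f,g$ coprime polynomials, $g\neq0$, set $\|C\|=\max(1+\deg f,\deg g)$ (equivalently, the dimension of the span of $C,\tau(C),\tau^2(C),\dots$ where $\tau(\sum\gamma_nX^n)=\sum\gamma_{n+1}X^n$). The map $\exp_!:X\overline{\mathbb F}_p[[X]]\to 1+X\overline{\mathbb F}_p[[X]]$ is defined by: for $A=\sum_{n\ge1}\alpha_nX^n$, if $\exp(\sum_{n\ge1}\alpha_nX^n/n!)=1+\sum_{n\ge1}\beta_nX^n/n!$ (formally over $\mathbb Z$, the $\beta_n$ being integer polynomials in the $\alpha_i$), then $\exp_!(A)=1+\sum\beta_nX^n$. The map $\log_!$ is its inverse bijection $1+X\overline{\mathbb F}_p[[X]]\to X\overline{\mathbb F}_p[[X]]$ (corresponding likewise to the logarithm of exponential generating series). *)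

(* Defs.v *)
From HB Require Import structures.
From mathcomp Require Import all_boot all_order all_algebra all_field.
From mathcomp Require Import mpoly.
From Stdlib Require Import ClassicalEpsilon.

Set Implicit Arguments.
Unset Strict Implicit.
Unset Printing Implicit Defensive.

Import GRing.Theory Num.Theory.

Local Open Scope ring_scope.

(* A formal power series is its sequence of coefficients. *)
Definition series (K : Type) := nat -> K.

Section Rational.
Variable K : fieldType.
Implicit Types (C : series K) (f g : {poly K}).

Definition reduced_fraction C f g : Prop :=
  [/\ coprimep f g, g != 0 &
      forall n, \sum_(i < n.+1) g`_i * C (n - i)%N = f`_n].

Definition rational C : Prop := exists f g, reduced_fraction C f g.

(* [size f] is [1 + deg f], with value 0 at [f = 0]. *)
Definition fraction_norm f g : nat := maxn (size f) (size g).-1.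

(* Meaningful for rational series only; see [series_normE]. *)
Definition series_norm C : nat :=
  epsilon (inhabits 0%N)
    (fun d => exists f g, reduced_fraction C f g /\ d = fraction_norm f g).

Lemma reduced_fraction_cross C f1 g1 f2 g2 :
  reduced_fraction C f1 g1 -> reduced_fraction C f2 g2 -> f1 * g2 = f2 * g1.
Proof.
move=> [_ _ E1] [_ _ E2].
pose P n := \poly_(i < n) C i.
have E f g n m : (m < n)%N ->
    (forall k, \sum_(i < k.+1) g`_i * C (k - i)%N = f`_k) ->
    (g * P n)`_m = f`_m.
  move=> ltmn Ef; rewrite coefM -Ef; apply: eq_bigr => i _.
  by rewrite coef_poly (leq_ltn_trans (leq_subr _ _) ltmn).
apply/polyP => n.
have -> : (f1 * g2)`_n = (g1 * P n.+1 * g2)`_n.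
  rewrite !coefM; apply: eq_bigr => i _.
  by rewrite (E f1) // ltn_ord.
have -> : (f2 * g1)`_n = (g2 * P n.+1 * g1)`_n.
  rewrite !coefM; apply: eq_bigr => i _.
  by rewrite (E f2) // ltn_ord.
by rewrite mulrAC -mulrA mulrC.
Qed.

Lemma series_normE C f g :
  reduced_fraction C f g -> series_norm C = fraction_norm f g.
Proof.
move=> red.
have /(epsilon_spec (inhabits 0%N)) : exists d,
    exists f' g', reduced_fraction C f' g' /\ d = fraction_norm f' g'.
  by exists (fraction_norm f g), f, g.
rewrite -/(series_norm C) => -[f' [g' [red' ->]]].
have E := reduced_fraction_cross red red'.
have [cop nz _] := red; have [cop' nz' _] := red'.
have gg' : g %= g'.
  have h : coprimep g f by rewrite coprimep_sym.
  have h' : coprimep g' f' by rewrite coprimep_sym.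
  rewrite /eqp -(Gauss_dvdpr _ h) E dvdp_mull //=.
  by rewrite -(Gauss_dvdpr _ h') -E dvdp_mull.
have ff' : f %= f'.
  rewrite /eqp -(Gauss_dvdpl _ cop) -E dvdp_mulr //=.
  by rewrite -(Gauss_dvdpl _ cop') E dvdp_mulr.
by rewrite /fraction_norm (eqp_size ff') (eqp_size gg').
Qed.

End Rational.

Section EGF.
Variable L : comAlgType rat.
Implicit Types a b : nat -> L.

(* [\sum_(1 <= i <= N) (a i / i!) 'X^i]; the value [a 0] is ignored. *)
Definition egf a N : {poly L} :=
  \poly_(i < N.+1) (if i == 0%N then 0 else (i`!%:R^-1 : rat) *: a i).

(* [n!] times the coefficient of ['X^n] in [exp U], resp. in [log (1 + U)], for
   [U = \sum_(i >= 1) (a i / i!) 'X^i]: the truncation at order [n] does not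
   affect this coefficient, since ['X] divides [U]. *)
Definition egf_exp a n : L :=
  (\sum_(k < n.+1) (k`!%:R^-1 : rat)%:A *: egf a n ^+ k)`_n *+ n`!.

Definition egf_log a n : L :=
  (\sum_(k < n) ((-1) ^+ k / k.+1%:R : rat)%:A *: egf a n ^+ k.+1)`_n *+ n`!.

End EGF.

Section Bang.

(* ['X_i] stands for the coefficient of index [i]. *)
Definition generic_seq n : nat -> {mpoly rat[n.+1]} := fun i => 'X_(inord i).

(* Taking numerators of coefficients loses nothing, as both polynomials have
   integral coefficients: see [exp_polyP] and [log_polyP]. *)
Definition exp_poly n : {mpoly int[n.+1]} :=
  map_mpoly numq (egf_exp (generic_seq n) n).
Definition log_poly n : {mpoly int[n.+1]} :=
  map_mpoly numq (egf_log (generic_seq n) n).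

Variable K : comNzRingType.
Implicit Types A B : series K.

(* [exp_!] on series with constant term 0 and [log_!] on series with constant
   term 1; the constant term itself is ignored. They are inverse to each
   other: see [exp_bangK] and [log_bangK]. *)
Definition exp_bang A : series K :=
  fun n => mmap (intr : int -> K) (fun i => A i) (exp_poly n).
Definition log_bang B : series K :=
  fun n => mmap (intr : int -> K) (fun i => B i) (log_poly n).

Definition one_plus A : series K := fun n => (n == 0%N)%:R + A n.

End Bang.

(* The recursion [B' = A' B] relating [B = exp A] and [A], read on the
   coefficients of index at most [N] of the exponential generating series. *)
Definition egf_rec (R : comNzRingType) (a b : nat -> R) N : Prop :=
  b 0%N = 1 /\ forall m, (m < N)%N ->
    b m.+1 = \sum_(j < m.+1) (a j.+1 * b (m - j)%N) *+ 'C(m, j).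

Section EGFRec.
Variable L : comAlgType rat.
Implicit Types a b : nat -> L.

Lemma egf_coef a N i : (0 < i <= N)%N -> (egf a N)`_i *+ i`! = a i.
Proof.
case/andP; case: i => // i _ leiN; rewrite coef_poly ltnS leiN /=.
rewrite scalerMnl -mulr_natr mulVf ?scale1r //.
by rewrite pnatr_eq0 -lt0n fact_gt0.
Qed.

Lemma egf_leibniz (G H : {poly L}) m :
  (G * H)`_m *+ m`! =
  \sum_(j < m.+1) ((G`_j *+ j`!) * (H`_(m - j) *+ (m - j)`!)) *+ 'C(m, j).
Proof.
rewrite coefM -sumrMnl; apply: eq_bigr => j _.
rewrite mulrnAl mulrnAr -!mulrnA; congr (_ *+ _).
have /bin_fact <- : (j <= m)%N by rewrite -ltnS.
by rewrite mulnC -mulnA mulnCA.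
Qed.

Lemma coef_derivf (G : {poly L}) m : G^`()`_m *+ m`! = G`_m.+1 *+ (m.+1)`!.
Proof. by rewrite coef_deriv -mulrnA factS. Qed.

Lemma egf_pow_small a N k m : (m < k)%N -> (egf a N ^+ k)`_m = 0.
Proof.
move=> ltmk; suff [V ->] : exists V, egf a N = V * 'X.
  by rewrite exprMn coefMXn ltmk.
exists (\poly_(i < N) (egf a N)`_i.+1); apply/polyP => -[|i].
  by rewrite coefMX /= coef_poly.
rewrite coefMX /= [RHS]coef_poly; case: ltnP => // leNi.
by rewrite /egf coef_poly ltnS ltnNge leNi.
Qed.

Lemma scaleAMn (c : rat) (G : {poly L}) n :
  c%:A *: (G *+ n) = (c *+ n)%:A *: G.
Proof. by rewrite -scalerMnr scalerMnl [_%:A *+ _]scalerMnl. Qed.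

Lemma egf_exp_rec a N : exists2 b,
  egf_rec a b N & b N = egf_exp a N.
Proof.
pose U := egf a N; pose E := \sum_(k < N.+1) (k`!%:R^-1 : rat)%:A *: U ^+ k.
exists (fun m => E`_m *+ m`!) => //.
split=> [|m ltmN].
  rewrite mulr1n coef_sum big_ord_recl big1 ?addr0 => [|i _].
    by rewrite expr0 coefZ coefC invr1 scale1r mulr1.
  by rewrite coefZ egf_pow_small // mulr0.
have dE : E^`() = U^`() * (E - (N`!%:R^-1 : rat)%:A *: U ^+ N).
  rewrite {2}/E big_ord_recr /= addrK /E raddf_sum big_ord_recl /=.
  rewrite derivZ derivC scaler0 add0r mulr_sumr; apply: eq_bigr => k _.
  rewrite derivZ deriv_exp /= scaleAMn -scalerAr; congr (_%:A *: _).
  rewrite /bump /= add1n factS natrM invfM -mulrnAl -[_ *+ _]mulr_natl mulfV ?mul1r //.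
  by rewrite pnatr_eq0.
rewrite -coef_derivf dE egf_leibniz; apply: eq_bigr => j _; congr (_ *+ _).
rewrite coef_derivf egf_coef; last by rewrite /= (leq_trans (ltn_ord j)).
rewrite coefB coefZ egf_pow_small ?mulr0 ?subr0 //.
exact: leq_ltn_trans (leq_subr _ _) ltmN.
Qed.

Lemma egf_log_rec b N : (0 < N)%N -> b 0%N = 1 -> exists2 a,
  egf_rec a b N & a N = egf_log b N.
Proof.
move=> N0 b0; pose U := egf b N.
pose G := \sum_(k < N) ((-1) ^+ k / k.+1%:R : rat)%:A *: U ^+ k.+1.
exists (fun m => G`_m *+ m`!) => //.
split=> // m ltmN.
have dG : G^`() * (1 + U) = U^`() * (1 - (- U) ^+ N).
  have -> : 1 - (- U) ^+ N = (1 + U) * \sum_(k < N) (- U) ^+ k.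
    rewrite -[X in X - _](expr1n _ N) subrXX opprK; congr (_ * _).
    by apply: eq_bigr => k _; rewrite expr1n mul1r.
  rewrite mulrCA mulrC; congr (_ * _).
  rewrite /G raddf_sum mulr_sumr; apply: eq_bigr => k _ /=.
  rewrite derivZ deriv_exp /= scaleAMn -[_ / _ *+ _]mulr_natr.
  rewrite divfK ?pnatr_eq0 // [(- U) ^+ k]exprNn mulrCA -mul_polyC; congr (_ * _).
  rewrite -signr_odd -[RHS]signr_odd.
  by case: odd; rewrite ?expr0 ?expr1 ?scale1r ?scaleN1r ?polyCN.
have -> : b m.+1 = (G^`() * (1 + U))`_m *+ m`!.
  rewrite dG mulrBr mulr1 coefB [X in _ - X]coefM big1 => [|i _].
    by rewrite subr0 coef_derivf egf_coef.
  rewrite exprNn -signr_odd mulr_sign (fun_if (fun p : {poly L} => p`_(m - i))).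
  rewrite coefN egf_pow_small ?oppr0 ?if_same ?mulr0 //.
  exact: leq_ltn_trans (leq_subr _ _) ltmN.
rewrite egf_leibniz; apply: eq_bigr => j _; congr (_ *+ _).
rewrite coef_derivf; congr (_ * _).
rewrite coefD coef1; case: (posnP (m - j)) => [->|mj].
  by rewrite coef_poly addr0.
rewrite /= add0r egf_coef // mj.
exact: leq_trans (leq_subr _ _) (ltnW ltmN).
Qed.
End EGFRec.

Section Bell.
Variable R : comNzRingType.
Implicit Types a b : nat -> R.

(* The solutions [b], resp. [a], of [egf_rec a b n], up to index [n]. *)
Fixpoint rec_exp a n : nat -> R :=
  if n isn't m.+1 then fun=> 1 else fun i =>
  if i == n then \sum_(j < n) (a j.+1 * rec_exp a m (m - j)%N) *+ 'C(m, j)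
  else rec_exp a m i.

Fixpoint rec_log b n : nat -> R :=
  if n isn't m.+1 then fun=> 0 else fun i =>
  if i == n then
    b n - \sum_(j < m) (rec_log b m j.+1 * b (m - j)%N) *+ 'C(m, j)
  else rec_log b m i.

Lemma rec_exp_uniq a b n i : egf_rec a b n -> (i <= n)%N -> b i = rec_exp a n i.
Proof.
elim: n i => [|n IH] i [b0 rec].
  by rewrite leqn0 => /eqP ->.
have {}IH j : (j <= n)%N -> b j = rec_exp a n j.
  by apply: IH; split=> // k ltkn; apply/rec/ltnW.
rewrite leq_eqVlt /= => /predU1P[->|ltin].
  by rewrite eqxx rec //; apply: eq_bigr => j _; rewrite IH ?leq_subr.
by rewrite ltn_eqF // IH.
Qed.

Lemma rec_log_uniq a b n i :
  egf_rec a b n -> (0 < i <= n)%N -> a i = rec_log b n i.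
Proof.
elim: n i => [|n IH] i [b0 rec]; first by case: i.
have {}IH j : (0 < j <= n)%N -> a j = rec_log b n j.
  by apply: IH; split=> // k ltkn; apply/rec/ltnW.
case/andP=> i0; rewrite leq_eqVlt /= => /predU1P[->|ltin].
  rewrite eqxx rec // big_ord_recr /= subnn b0 mulr1 binn mulr1n addrC -[LHS]addr0.
  rewrite -addrA; congr (_ + _); rewrite -sumrB big1 // => j _.
  by rewrite -IH ?subrr //= ltn_ord.
by rewrite ltn_eqF // IH // i0.
Qed.

Lemma rec_expP a n : egf_rec a (rec_exp a n) n.
Proof.
split=> [|m]; first by elim: n => //= n ->.
elim: n => // n IH; rewrite ltnS leq_eqVlt => /predU1P[->|ltmn] /=.
  rewrite eqxx; apply: eq_bigr => j _.
  by rewrite ltn_eqF // ltnS leq_subr.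
rewrite ltn_eqF // IH //; apply: eq_bigr => j _.
by rewrite ltn_eqF // (leq_ltn_trans (leq_subr _ _)) // ltnW.
Qed.

Lemma rec_logP b n : b 0%N = 1 -> egf_rec (rec_log b n) b n.
Proof.
move=> b0; split=> // m.
elim: n => // n IH; rewrite ltnS leq_eqVlt => /predU1P[->|ltmn] /=.
  rewrite big_ord_recr /= eqxx subnn b0 binn mulr1 mulr1n.
  rewrite -[LHS](subrK (\sum_(j < n) (rec_log b n j.+1 * b (n - j)%N) *+ 'C(n, j))).
  rewrite addrC; congr +%R; apply: eq_bigr => j _.
  by rewrite eqSS ltn_eqF.
rewrite IH //; apply: eq_bigr => j _.
by rewrite eqSS ltn_eqF // (leq_trans (ltn_ord j)).
Qed.

Lemma rec_log_diag b n i : (i <= n)%N -> rec_log b n i = rec_log b i i.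
Proof.
move=> lein; rewrite -(subnK lein); elim: (n - i)%N => //= k IH.
by rewrite ltn_eqF // ltnS leq_addl.
Qed.

Lemma rec_exp_diag a n i : (i <= n)%N -> rec_exp a n i = rec_exp a i i.
Proof.
move=> lein; rewrite -(subnK lein); elim: (n - i)%N => //= k IH.
by rewrite ltn_eqF // ltnS leq_addl.
Qed.

Lemma eq_rec_exp a a' n i : {in [pred i | (0 < i <= n)%N], a =1 a'} ->
  rec_exp a n i = rec_exp a' n i.
Proof.
elim: n i => //= n IH i eqa.
have {}IH j : rec_exp a n j = rec_exp a' n j.
  by apply: IH => k /andP[k0 kn]; apply: eqa; rewrite inE k0 leqW.
case: eqP => // _; apply: eq_bigr => j _.
by rewrite IH eqa // inE /= ltn_ord.
Qed.

Lemma eq_rec_log b b' n i : {in [pred i | (0 < i <= n)%N], b =1 b'} ->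
  rec_log b n i = rec_log b' n i.
Proof.
elim: n i => //= n IH i eqb.
have {}IH j : rec_log b n j = rec_log b' n j.
  by apply: IH => k /andP[k0 kn]; apply: eqb; rewrite inE k0 leqW.
case: eqP => // _; rewrite eqb ?inE ?leqnn //.
suff /= -> : \sum_(j < n) (rec_log b n j.+1 * b (n - j)%N) *+ 'C(n, j) =
          \sum_(j < n) (rec_log b' n j.+1 * b' (n - j)%N) *+ 'C(n, j) by [].
apply: eq_bigr => j _.
by rewrite IH eqb // inE subn_gt0 ltn_ord leqW // leq_subr.
Qed.
End Bell.

Section Morph.
Variables (R S : comNzRingType) (f : {rmorphism R -> S}).

Lemma rmorph_rec_exp (a : nat -> R) n i :
  f (rec_exp a n i) = rec_exp (f \o a) n i.
Proof.
elim: n i => [|n IH] i /=; first by rewrite rmorph1.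
case: eqP => // _; rewrite rmorph_sum; apply: eq_bigr => j _.
by rewrite rmorphMn rmorphM IH.
Qed.

Lemma rmorph_rec_log (b : nat -> R) n i :
  f (rec_log b n i) = rec_log (f \o b) n i.
Proof.
elim: n i => [|n IH] i /=; first by rewrite rmorph0.
case: eqP => // _; rewrite rmorphB rmorph_sum /=.
by under eq_bigr do rewrite rmorphMn rmorphM IH.
Qed.
End Morph.

Lemma egf_expE (L : comAlgType rat) (a : nat -> L) n :
  egf_exp a n = rec_exp a n n.
Proof. by have [b rec <-] := egf_exp_rec a n; apply: rec_exp_uniq. Qed.

Lemma egf_logE (L : comAlgType rat) (b : nat -> L) n :
  egf_log b n = rec_log b n n.
Proof.
case: n => [|n]; first by rewrite /egf_log big_ord0 coef0 mul0rn.
pose b1 i := if i == 0%N then 1 else b i.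
have -> : egf_log b n.+1 = egf_log b1 n.+1.
  suff E : egf b n.+1 = egf b1 n.+1 by rewrite /egf_log E.
  by apply/polyP => i; rewrite /egf /b1 !coef_poly; case: i.
have [//|//|a rec <-] := @egf_log_rec L b1 n.+1.
rewrite (rec_log_uniq rec) //=; apply: (@eq_rec_log _ b1 b n.+1 n.+1).
by move=> [|i] /andP[].
Qed.

Definition generic_seqZ n : nat -> {mpoly int[n.+1]} := fun i => 'X_(inord i).

Lemma mcoeff_numq n (Q : {mpoly rat[n]}) m :
  (map_mpoly numq Q)@_m = numq Q@_m.
Proof.
rewrite /map_mpoly /mmap raddf_sum /=.
under eq_bigr do rewrite mmap1_id mcoeffCM mcoeffX.
have [mQ|mQ] := boolP (m \in msupp Q).
  rewrite (bigD1_seq m) //= eqxx mulr1 big1 ?addr0 // => m' /negPf ->.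
  by rewrite mulr0.
rewrite (memN_msupp_eq0 mQ) big_seq big1 // => m' m'Q.
by case: eqP => [E|]; rewrite ?mulr0 //; rewrite -E m'Q in mQ.
Qed.

Lemma numqK n (P : {mpoly int[n]}) :
  map_mpoly numq (map_mpoly (intr : int -> rat) P) = P.
Proof.
by apply/mpolyP => m; rewrite mcoeff_numq mcoeff_map_mpoly numq_int.
Qed.

Lemma map_generic n :
  map_mpoly (intr : int -> rat) \o generic_seqZ n =1 generic_seq n.
Proof. by move=> i; rewrite /= map_mpolyX. Qed.

Lemma exp_polyE n : exp_poly n = rec_exp (generic_seqZ n) n n.
Proof.
rewrite /exp_poly egf_expE -[RHS]numqK rmorph_rec_exp.
by congr map_mpoly; apply: eq_rec_exp => i _; rewrite map_generic.
Qed.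

Lemma log_polyE n : log_poly n = rec_log (generic_seqZ n) n n.
Proof.
rewrite /log_poly egf_logE -[RHS]numqK rmorph_rec_log.
by congr map_mpoly; apply: eq_rec_log => i _; rewrite map_generic.
Qed.

Lemma exp_polyP n :
  map_mpoly (intr : int -> rat) (exp_poly n) = egf_exp (generic_seq n) n.
Proof.
rewrite exp_polyE egf_expE rmorph_rec_exp.
by apply: eq_rec_exp => i _; rewrite map_generic.
Qed.

Lemma log_polyP n :
  map_mpoly (intr : int -> rat) (log_poly n) = egf_log (generic_seq n) n.
Proof.
rewrite log_polyE egf_logE rmorph_rec_log.
by apply: eq_rec_log => i _; rewrite map_generic.
Qed.

Section BangFacts.
Variable K : comNzRingType.
Implicit Types A B : series K.

Lemma exp_bangE A n : exp_bang A n = rec_exp A n n.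
Proof.
rewrite /exp_bang exp_polyE rmorph_rec_exp.
apply: eq_rec_exp => i /andP[_ lein].
by rewrite /= mmapX mmap1U inordK.
Qed.

Lemma log_bangE B n : log_bang B n = rec_log B n n.
Proof.
rewrite /log_bang log_polyE rmorph_rec_log.
apply: eq_rec_log => i /andP[_ lein].
by rewrite /= mmapX mmap1U inordK.
Qed.

Lemma exp_bangK A : A 0%N = 0 -> log_bang (exp_bang A) =1 A.
Proof.
move=> A0 [|n]; first by rewrite log_bangE.
have rec : egf_rec A (exp_bang A) n.+1.
  have [b0 rec] := rec_expP A n.+1.
  split=> [|m ltmn]; first by rewrite exp_bangE.
  rewrite exp_bangE -(rec_exp_diag _ ltmn) rec //; apply: eq_bigr => j _.
  by rewrite exp_bangE rec_exp_diag // (leq_trans (leq_subr _ _)) // ltnW.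
by rewrite log_bangE -(rec_log_uniq rec) //=.
Qed.

Lemma log_bangK B : B 0%N = 1 -> exp_bang (log_bang B) =1 B.
Proof.
move=> B0 n; rewrite exp_bangE (rec_exp_uniq (rec_logP n B0)) //.
apply: eq_rec_exp => i /andP[_ lein].
by rewrite log_bangE rec_log_diag.
Qed.
End BangFacts.

(* Main.v *)
(* Under [A |-> \sum_n A_n X^n / n!] the product of exponential generating
   series becomes the shuffle product, for which the shift of coefficients is
   a derivation.  A series is rational of norm at most [N] iff it lies in a
   shift-stable space spanned by [N] series.  In characteristic [p] the shift
   kills [p]-th powers, so these are constants.  Hence the algebra generated by
   the shifts of [A] has dimension at most [p ^ d], where [d] is the norm of [A],
   and its multiple by [E = exp_! A] is shift-stable because [E' = A' E]; this
   gives the bound [p ^ d <= p ^ q ^ d].  For [B = 1 + A] we have [B ^+ p = 1],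
   so [(log_! B)' = B' B ^+ (p - 1)] lies in the span of the [p]-fold products
   of shifts of [B]. *)

Require Import Defs.
From HB Require Import structures.
From mathcomp Require Import all_boot all_order all_algebra all_field.
From mathcomp Require Import boolp.

Set Implicit Arguments.
Unset Strict Implicit.
Unset Printing Implicit Defensive.

Import GRing.Theory.

Local Open Scope ring_scope.

(* The ring structure put on [series K] below is the shuffle algebra, not the
   Cauchy product. *)
HB.instance Definition _ (K : Type) := gen_eqMixin (series K).
HB.instance Definition _ (K : Type) := gen_choiceMixin (series K).

(** * The shuffle algebra of series and its derivation [shift] *)

Section Shuffle.
Variable K : comNzRingType.
Implicit Types (a b c : series K) (k : K).

Definition series_add a b : series K := fun n => a n + b n.
Definition series_opp a : series K := fun n => - a n.
Definition series_zero : series K := fun=> 0.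
Definition series_scale k a : series K := fun n => k * a n.
Definition series_one : series K := fun n => (n == 0%N)%:R.

Fact series_addA : associative series_add.
Proof. by move=> a b c; apply: funext => n; apply: addrA. Qed.
Fact series_addC : commutative series_add.
Proof. by move=> a b; apply: funext => n; apply: addrC. Qed.
Fact series_add0 : left_id series_zero series_add.
Proof. by move=> a; apply: funext => n; apply: add0r. Qed.
Fact series_addN : left_inverse series_zero series_opp series_add.
Proof. by move=> a; apply: funext => n; apply: addNr. Qed.

HB.instance Definition _ := GRing.isZmodule.Build (series K)
  series_addA series_addC series_add0 series_addN.

Definition shift a : series K := fun n => a n.+1.

(* The coefficientwise form of the Leibniz rule for [shift]; see [shuffleE] for
   the closed formula. *)
Fixpoint shuffle a b n : K :=
  if n is m.+1 then shuffle (shift a) b m + shuffle a (shift b) m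
  else a 0%N * b 0%N.

Fact shuffleC : commutative (shuffle : series K -> series K -> series K).
Proof.
move=> a b; apply: funext => n; elim: n a b => /= [|n IH] a b.
  exact: mulrC.
by rewrite addrC !(IH _ b) (IH (shift b)).
Qed.

Fact shuffleDl :
  left_distributive (shuffle : series K -> series K -> series K) +%R.
Proof.
move=> a b c; apply: funext => n; elim: n a b c => /= [|n IH] a b c.
  exact: mulrDl.
by rewrite (IH (shift a) (shift b)) IH addrACA.
Qed.

(** Both sides expand under [shift] into the same three Leibniz terms, so induction on the index
    applies. *)
Fact shuffleA : associative (shuffle : series K -> series K -> series K).
Proof.
move=> a b c; apply: funext => n; elim: n a b c => [|n IH] a b c.
  exact: mulrA.
have Dl x y z : shuffle (x + y) z n = shuffle x z n + shuffle y z n.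
  by rewrite shuffleDl.
have Dr x y z : shuffle x (y + z) n = shuffle x y n + shuffle x z n.
  by rewrite !(shuffleC x) Dl.
transitivity (shuffle (shift a) (shuffle b c) n +
    shuffle a ((shuffle (shift b) c : series K) + shuffle b (shift c)) n) => //.
transitivity (shuffle ((shuffle (shift a) b : series K) + shuffle a (shift b)) c n +
    shuffle (shuffle a b) (shift c) n) => //.
by rewrite Dl Dr !IH addrA.
Qed.

Fact shuffle1 :
  left_id series_one (shuffle : series K -> series K -> series K).
Proof.
move=> a; apply: funext => n; elim: n a => /= [|n IH] a; first exact: mul1r.
rewrite IH (_ : shift _ = 0 :> series K); last exact: funext.
(* The ring structure is still being built: absorption by 0 comes from distributivity and
   cancellation. *)
suff -> : (shuffle 0 a : series K) = 0 by apply: add0r.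
by apply: (@addIr (series K) (shuffle 0 a)); rewrite -shuffleDl !add0r.
Qed.

Fact series_oner_neq0 : series_one != 0.
Proof.
by apply/eqP => /(congr1 (fun a : series K => a 0%N)) /eqP; rewrite oner_eq0.
Qed.

HB.instance Definition _ := GRing.Zmodule_isComNzRing.Build (series K)
  shuffleA shuffleC shuffle1 shuffleDl series_oner_neq0.

Fact series_scaleA k l a :
  series_scale k (series_scale l a) = series_scale (k * l) a.
Proof. by apply: funext => n; apply: mulrA. Qed.
Fact series_scale1 : left_id 1 series_scale.
Proof. by move=> a; apply: funext => n; apply: mul1r. Qed.
Fact series_scaleDr : right_distributive series_scale +%R.
Proof. by move=> k a b; apply: funext => n; apply: mulrDr. Qed.
Fact series_scaleDl a : {morph series_scale^~ a : k l / k + l}.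
Proof. by move=> k l; apply: funext => n; apply: mulrDl. Qed.

HB.instance Definition _ := GRing.Zmodule_isLmodule.Build K (series K)
  series_scaleA series_scale1 series_scaleDr series_scaleDl.

Fact series_scaleAl k a b : k *: (a * b) = k *: a * b.
Proof.
apply: funext => n; elim: n a b => [|n IH] a b; first exact: mulrA.
by rewrite /= -[RHS]/((k *: shift a * b) n + (k *: a * shift b) n) -!IH -mulrDr.
Qed.

HB.instance Definition _ :=
  GRing.Lmodule_isLalgebra.Build K (series K) series_scaleAl.
HB.instance Definition _ := GRing.Lalgebra_isComAlgebra.Build K (series K).

Fact shift_is_linear : linear shift.
Proof. by []. Qed.
HB.instance Definition _ :=
  GRing.isLinear.Build K (series K) (series K) *:%R shift shift_is_linear.

Lemma shiftM a b : shift (a * b) = shift a * b + a * shift b.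
Proof. by []. Qed.

Lemma shift1 : shift 1 = 0.
Proof. exact: funext. Qed.

Lemma shiftX a n : shift (a ^+ n) = a ^+ n.-1 * shift a *+ n.
Proof.
elim: n => [|n IH]; first by rewrite shift1 mulr0n.
rewrite exprS shiftM IH mulrS mulrC; congr (_ + _).
by case: n {IH} => [|n]; rewrite ?mulr0 // mulrnAr mulrA -exprS.
Qed.

Lemma series_sumE (I : Type) (r : seq I) (P : pred I) (F : I -> series K) n :
  (\sum_(i <- r | P i) F i) n = \sum_(i <- r | P i) F i n.
Proof. exact: (big_morph (fun a : series K => a n)). Qed.

Lemma series_expr0 a n : (a ^+ n) 0%N = a 0%N ^+ n.
Proof. by elim: n => // n IH; rewrite !exprS -IH. Qed.

(** Unlike the formal derivative, [shift] introduces no factor [n], so its kernel is the scalars in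
    every characteristic. *)
Lemma shift_eq0 a : shift a = 0 -> a = (a 0%N)%:A.
Proof.
move=> a0; apply: funext => -[|n]; first exact/esym/mulr1.
by rewrite -[LHS]/(shift a n) a0; apply/esym/mulr0.
Qed.

(** Pascal's rule merges the two Leibniz terms. The sum has the form of the one in [egf_rec], which
    thus reads [B' = A' B]. *)
Lemma shuffleE a b n :
  (a * b) n = \sum_(j < n.+1) (a j * b (n - j)%N) *+ 'C(n, j).
Proof.
elim: n a b => [|n IH] a b; first by rewrite big_ord_recl big_ord0 addr0 bin0.
rewrite -[LHS]/((shift a * b) n + (a * shift b) n) !IH.
rewrite [RHS]big_ord_recl /= bin0 mulr1n subn0.
under [in RHS]eq_bigr => i _ do rewrite /bump /= add1n subSS binS mulrnDr.
rewrite big_split /= addrA addrC; congr (_ + _).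
rewrite big_ord_recl /= bin0 subn0 mulr1n; congr (_ + _).
rewrite [RHS]big_ord_recr /= bin_small // mulr0n addr0.
apply: eq_bigr => i _; by rewrite /bump /= add1n /shift subnSK.
Qed.

Lemma shift_exp_bang a : shift (exp_bang a) = shift a * exp_bang a.
Proof.
apply: funext => n; rewrite shuffleE /shift exp_bangE.
have [_ ->] // := rec_expP a n.+1; apply: eq_bigr => j _.
by rewrite exp_bangE rec_exp_diag // (leq_trans (leq_subr _ _)).
Qed.

Lemma shift_log_bang b : b 0%N = 1 -> shift b = shift (log_bang b) * b.
Proof.
move=> b0; apply: funext => n; rewrite shuffleE /shift.
have [_ ->] // := rec_logP n.+1 b0; apply: eq_bigr => j _.
by rewrite log_bangE rec_log_diag.
Qed.

(* Since [shift] is a derivation, it kills [p]-th powers. *)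
Lemma expr_pchar p a : p \in [pchar K] -> a ^+ p = (a 0%N ^+ p)%:A.
Proof.
move=> cp; rewrite -series_expr0; apply: shift_eq0.
rewrite shiftX -scaler_nat (pcharf0 cp); exact: scale0r.
Qed.

End Shuffle.

(** * Series in finitely generated [shift]-stable spaces *)

Section Recognizable.
Variable K : comNzRingType.
Implicit Types s t : series K.

Definition span (I : finType) (w : I -> series K) s :=
  exists c : I -> K, s = \sum_i c i *: w i.

(** The generators may be dependent, so [N] only bounds the dimension. Any finite index type is
    allowed, so that pairs, options and exponent vectors can serve as indices. *)
Definition recognizable N s := exists (I : finType) (w : I -> series K),
  [/\ #|I| = N, forall i, span w (shift (w i)) & span w s].

Section Span.
Variables (I : finType) (w : I -> series K).

Lemma spanD s t : span w s -> span w t -> span w (s + t).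
Proof.
move=> [c ->] [d ->]; exists (fun i => c i + d i).
by rewrite -big_split; apply: eq_bigr => i _; rewrite scalerDl.
Qed.

Lemma spanZ k s : span w s -> span w (k *: s).
Proof.
move=> [c ->]; exists (fun i => k * c i).
by rewrite scaler_sumr; apply: eq_bigr => i _; rewrite scalerA.
Qed.

Lemma span0 : span w 0.
Proof. by exists (fun=> 0); rewrite big1 // => i _; apply: scale0r. Qed.

Lemma span_sum (J : Type) (r : seq J) (F : J -> series K) :
  (forall j, span w (F j)) -> span w (\sum_(j <- r) F j).
Proof. by move=> wF; apply: big_ind => //; [exact: span0 | exact: spanD]. Qed.

Lemma span_gen i : span w (w i).
Proof.
exists (fun j => (j == i)%:R); rewrite (bigD1 i) //= eqxx scale1r big1 ?addr0 //.
by move=> j /negPf ->; apply: scale0r.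
Qed.

End Span.

Lemma span_trans (I J : finType) (v : I -> series K) (w : J -> series K) s :
  (forall i, span w (v i)) -> span v s -> span w s.
Proof. by move=> wv [c ->]; apply: span_sum => i; apply: spanZ. Qed.

Lemma span_mul (I J : finType) (v : I -> series K) (w : J -> series K) s t :
  span v s -> span w t -> span (fun ij : I * J => v ij.1 * w ij.2) (s * t).
Proof.
move=> [c ->] [d ->]; rewrite mulr_suml; apply: span_sum => i.
rewrite mulr_sumr; apply: span_sum => j.
rewrite -scalerAl -scalerAr; do 2!apply: spanZ.
exact: (span_gen _ (i, j)).
Qed.

Lemma recognizableM M N s t :
  recognizable M s -> recognizable N t -> recognizable (M * N) (s * t).
Proof.
move=> [I [v [<- vS vs]]] [J [w [<- wS wt]]].
exists (I * J)%type, (fun ij => v ij.1 * w ij.2).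
split; [exact: card_prod | move=> [i j] /= | exact: span_mul].
by rewrite shiftM; apply: spanD; apply: span_mul => //; apply: span_gen.
Qed.

Lemma recognizable1 : recognizable 1 1.
Proof.
exists unit, (fun=> 1); split; first exact: card_unit.
  by move=> _; rewrite shift1; apply: span0.
exact: (span_gen (fun=> 1) tt).
Qed.

Lemma recognizableX N s k : recognizable N s -> recognizable (N ^ k) (s ^+ k).
Proof.
move=> Ns; elim: k => [|k IH]; first exact: recognizable1.
by rewrite exprS expnS; apply: recognizableM.
Qed.

Lemma recognizable_shift N s : recognizable N s -> recognizable N (shift s).
Proof.
move=> [I [w [cI wS [c ->]]]]; exists I, w; split=> //.
by rewrite linear_sum; apply: span_sum => i; rewrite linearZ /=; apply: spanZ.
Qed.

(** Adjoining [s] itself to the generators costs one dimension: this is the summand 1 in the bound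
    for the logarithm. *)
Lemma recognizable_unshift N s :
  recognizable N (shift s) -> recognizable N.+1 s.
Proof.
move=> [I [w [<- wS ws]]]; exists (option I), (oapp w s).
have wP t : span w t -> span (oapp w s) t.
  by apply: span_trans => i; apply: (span_gen (oapp w s) (Some i)).
split; [exact: card_option | by case=> [i|] /=; apply: wP |].
exact: (span_gen (oapp w s) None).
Qed.

(** Ordinal indices let [shift] be represented by a square matrix. *)
Lemma recognizable_ord N s : recognizable N s ->
  exists w : 'I_N -> series K, (forall i, span w (shift (w i))) /\ span w s.
Proof.
move=> [I [w [<- wS ws]]]; exists (w \o enum_val).
have wP t : span w t -> span (w \o @enum_val I predT) t.
  apply: span_trans => i; rewrite -(enum_rankK i).
  exact: (span_gen (w \o @enum_val I predT)).
by split=> [i|]; apply: wP => /=.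
Qed.

(* A [p]-th power being constant, the monomials in [w] with exponents less than
   [p] span the shuffle algebra generated by [w]; its multiple by [e] is stable
   under [shift]. *)
Lemma recognizable_exp p d s e : p \in [pchar K] -> recognizable d s ->
  shift e = shift s * e -> recognizable (p ^ d) e.
Proof.
move=> cp [I [w [<- wS ws]]] eS.
have p0 := prime_gt0 (pcharf_prime cp).
pose W (a : {ffun I -> 'I_p}) := (\prod_i w i ^+ a i) * e.
(* Since [p]-th powers are scalars, exponents reduce modulo [p] up to a scalar factor. *)
have monP (b : I -> nat) : span W ((\prod_i w i ^+ b i) * e).
  pose r := [ffun i => Ordinal (ltn_pmod (b i) p0)].
  have -> : \prod_i w i ^+ b i =
      \prod_i ((w i 0%N ^+ p) ^+ (b i %/ p) *: w i ^+ r i).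
    apply: eq_bigr => i _; rewrite ffunE /= {1}(divn_eq (b i) p) exprD mulnC.
    by rewrite exprM (expr_pchar _ cp) exprZn expr1n -scalerAl mul1r.
  by rewrite scaler_prod -scalerAl; apply/spanZ/(span_gen W r).
pose stab x := forall t, span W t -> span W (x * t).
have stab_w j : stab (w j).
  move=> t [c ->]; rewrite mulr_sumr; apply: span_sum => a.
  rewrite -scalerAr; apply: spanZ; rewrite mulrA.
  (* Multiplication by [w j] raises one exponent, possibly to [p]; [monP] absorbs the overflow. *)
  have -> : w j * \prod_i w i ^+ a i = \prod_i w i ^+ (a i + (i == j)).
    rewrite (bigD1 j) // [RHS](bigD1 j) //= eqxx addn1 exprS mulrA.
    by congr (_ * _); apply: eq_bigr => i /negPf ->; rewrite addn0.
  exact: monP.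
have stabP x : span w x -> stab x.
  move=> [c ->] t Wt; rewrite mulr_suml; apply: span_sum => i.
  by rewrite -scalerAl; apply/spanZ/stab_w.
(* By the Leibniz rule this condition passes to products, so the generators settle all monomials. *)
pose dstab x := stab x /\ stab (shift x).
have dstabM x y : dstab x -> dstab y -> dstab (x * y).
  move=> [x0 x1] [y0 y1]; split=> [|t Wt].
    by move=> t Wt; rewrite -mulrA; apply/x0/y0.
  by rewrite shiftM mulrDl -!mulrA; apply: spanD; [apply/x1/y0|apply/x0/y1].
have dstab1 : dstab 1.
  by rewrite /dstab shift1; split=> t; rewrite ?mul1r // mul0r => _; apply: span0.
have dstab_mon (a : {ffun I -> 'I_p}) : dstab (\prod_i w i ^+ a i).
  apply: (big_ind dstab) => // i _; elim: (a i : nat) => // n IH.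
  by rewrite exprS; apply: dstabM => //; split=> //; apply: stabP.
have We : span W e.
  have := monP (fun=> 0%N); rewrite big1 ?mul1r // => i _; exact: expr0.
exists {ffun I -> 'I_p}, W; split=> // [|a].
  by rewrite card_ffun card_ord.
have [mon0 mon1] := dstab_mon a.
rewrite shiftM eS; apply: spanD; first exact: mon1.
apply: mon0; apply: (stabP _ _ _ We).
have [c ->] := ws; rewrite linear_sum; apply: span_sum => i.
by rewrite linearZ /=; apply: spanZ.
Qed.

(* In characteristic [p], [b ^+ p = 1]: the logarithmic derivative of [b] is
   [shift b * b ^+ p.-1]. *)
Lemma recognizable_log p d (b : series K) : p \in [pchar K] -> b 0%N = 1 ->
  recognizable d b -> recognizable (d ^ p).+1 (log_bang b).
Proof.
move=> cp b0 db; apply: recognizable_unshift.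
have p0 := prime_gt0 (pcharf_prime cp).
have -> : shift (log_bang b) = shift b * b ^+ p.-1.
  rewrite (shift_log_bang b0) -mulrA -exprS prednK // (expr_pchar _ cp) b0.
  by rewrite expr1n scale1r mulr1.
rewrite -(prednK p0) expnS; apply: recognizableM.
  exact: recognizable_shift.
exact: recognizableX.
Qed.

End Recognizable.

(** * Rational series and recurrences *)

Section RationalNorm.
Variable K : fieldType.
Implicit Types (C : series K) (f g d h : {poly K}).

(** The ring product on series is the shuffle, so Cauchy products are computed on truncations. *)
Lemma coefM_trunc C g n m : (m < n)%N ->
  (g * \poly_(i < n) C i)`_m = \sum_(i < m.+1) g`_i * C (m - i)%N.
Proof.
move=> ltmn; rewrite coefM; apply: eq_bigr => i _.
by rewrite coef_poly (leq_ltn_trans (leq_subr _ _)).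
Qed.

(** A nonzero constant term makes [d] invertible modulo ['X^n]. *)
Lemma coef_eq0_mull d h n : d`_0 != 0 ->
  (forall m, (m < n)%N -> (d * h)`_m = 0) -> forall m, (m < n)%N -> h`_m = 0.
Proof.
move=> d0 dh0; elim/ltn_ind => m IH ltmn.
have := dh0 m ltmn; rewrite coefM big_ord_recl subn0 big1 ?addr0 => [|i _].
  by move/eqP; rewrite mulf_eq0 (negPf d0) => /eqP.
have lti : (m - lift ord0 i < m)%N.
  by rewrite /= ltn_subrL (leq_ltn_trans _ (ltn_ord i)).
by rewrite IH ?mulr0 // (ltn_trans lti).
Qed.

(** Reducing the fraction does not raise degrees, and the gcd inherits a nonzero constant term from
    [g], so it cancels. *)
Lemma fraction_norm_le C f g N : g`_0 != 0 ->
    (forall n, \sum_(i < n.+1) g`_i * C (n - i)%N = f`_n) ->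
    (size f <= N)%N -> (size g <= N.+1)%N ->
  rational C /\ (series_norm C <= N)%N.
Proof.
move=> g0 Cfg szf szg.
have gn0 : g != 0 by apply: contraNneq g0 => ->; rewrite coef0.
pose d := gcdp f g; pose f' := f %/ d; pose g' := g %/ d.
have Ef : f = d * f' by rewrite mulrC divpK ?dvdp_gcdl.
have Eg : g = d * g' by rewrite mulrC divpK ?dvdp_gcdr.
have d0 : d`_0 != 0.
  by apply: contraNneq g0 => d0; rewrite Eg coefM big_ord1 d0 mul0r.
have red : reduced_fraction C f' g'.
  split; first by rewrite coprimep_div_gcd // gn0 orbT.
    by apply: contraNneq gn0 => g'0; rewrite Eg g'0 mulr0.
  move=> n; rewrite -(coefM_trunc _ _ (ltnSn n)); apply/eqP.
  rewrite -subr_eq0 -coefB; apply/eqP.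
  apply: (@coef_eq0_mull d _ n.+1) => // m ltmn.
  by rewrite mulrBr mulrA -Eg -Ef coefB coefM_trunc // Cfg subrr.
split; first by exists f', g'.
rewrite (series_normE red) geq_max (leq_trans (leq_divp _ _) szf) /=.
by rewrite -subn1 leq_subLR add1n (leq_trans (leq_divp _ _) szg).
Qed.

(* Cayley-Hamilton: the reversed characteristic polynomial of the matrix of
   [shift] is a denominator. *)
Lemma recognizable_rational C N : recognizable N.+1 C ->
  rational C /\ (series_norm C <= N.+1)%N.
Proof.
move=> /recognizable_ord[w [/fin_all_exists[M wS] [c Cw]]].
pose A := \matrix_(i < N.+1, j < N.+1) M i j.
pose x n := \col_(i < N.+1) w i n.
have xS n : x n.+1 = A *m x n.
  apply/colP => i; rewrite !mxE -[LHS]/(shift (w i) n) wS series_sumE.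
  by apply: eq_bigr => j _; rewrite !mxE.
have xD n k : x (n + k)%N = A ^+ k *m x n.
  elim: k => [|k IH]; first by rewrite addn0 expr0 mul1mx.
  by rewrite addnS xS IH exprS mulmxA.
have Cx n : C n = ((\row_i c i) *m x n) 0 0.
  by rewrite Cw series_sumE mxE; apply: eq_bigr => i _; rewrite !mxE.
pose chi := char_poly A.
have chiC n : \sum_(k < N.+2) chi`_k * C (n + k)%N = 0.
  have CH : \sum_(k < N.+2) horner_mx A (chi`_k *: 'X^k) = 0.
    by rewrite -raddf_sum -(size_char_poly A) -poly_def coefK; apply: Cayley_Hamilton.
  transitivity (((\row_i c i) *m
      (\sum_(k < N.+2) horner_mx A (chi`_k *: 'X^k)) *m x n) 0 0).
    rewrite mulmx_sumr mulmx_suml summxE; apply: eq_bigr => k _.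
    rewrite linearZ /= rmorphXn /= horner_mx_X -scalemxAr -scalemxAl mxE.
    by rewrite -mulmxA -xD -Cx.
  by rewrite CH mulmx0 mul0mx mxE.
(* Reversal turns the leading coefficient 1 of [chi] into the constant term of [g]. *)
pose g := \poly_(i < N.+2) chi`_(N.+1 - i).
pose f := \poly_(n < N.+1) \sum_(i < n.+1) g`_i * C (n - i)%N.
apply: (@fraction_norm_le C f g); try exact: size_poly.
  rewrite coef_poly subn0 /= -[N.+1]/(N.+2.-1) -(size_char_poly A).
  by rewrite -/(lead_coef _) (monicP (char_poly_monic A)) oner_eq0.
move=> n; rewrite [RHS]coef_poly; case: ltnP => // leNn.
(* From index [N.+1] on, the coefficients of the Cauchy product of [g] and [C] are the recurrence
   read backwards, hence zero. *)
rewrite -[RHS](chiC (n - N.+1)%N) [RHS](reindex_inj rev_ord_inj) /=.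
rewrite [RHS](big_ord_widen n.+1
  (fun i => chi`_(N.+2 - i.+1) * C (n - N.+1 + (N.+2 - i.+1))%N)) //.
rewrite [RHS]big_mkcond; apply: eq_bigr => i _; rewrite coef_poly subSS.
case: ltnP => [lti|]; last by rewrite mul0r.
congr (_ * C _); rewrite ltnS in lti.
by rewrite addnBA // subnK.
Qed.

(* The series [shift^i C], for [i < series_norm C], span a [shift]-stable
   space: multiplication by the denominator is a linear recurrence. *)
Lemma rational_recognizable C :
  rational C -> recognizable (series_norm C) C.
Proof.
move=> [f [g red]]; rewrite (series_normE red).
have [cop _ Cfg] := red; set d := fraction_norm f g.
(* Otherwise 0 would be a common root of [f] and [g]. *)
have g0 : g`_0 != 0.
  apply/eqP => g0; have := Cfg 0%N; rewrite big_ord1 g0 mul0r => /esym f0.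
  have := @coprimep_root _ f g 0 cop.
  by rewrite /root !horner_coef0 f0 g0 eqxx => /(_ isT).
pose w (i : 'I_d) : series K := fun n => C (n + i)%N.
have wP k : (k <= d)%N -> span w (fun n => C (n + k)%N).
  rewrite leq_eqVlt => /predU1P[->|ltkd]; last exact: (span_gen w (Ordinal ltkd)).
  have -> : (fun n => C (n + d)%N) =
      \sum_(i < d) (- (g`_i.+1 / g`_0)) *: w (rev_ord i).
    apply: funext => n; rewrite series_sumE.
    have fnd : f`_(n + d) = 0.
      by rewrite nth_default // (leq_trans _ (leq_addl _ _)) // leq_maxl.
    have /eqP := Cfg (n + d)%N; rewrite fnd big_ord_recl subn0 addr_eq0.
    move=> /eqP gC; apply: (mulfI g0); rewrite {}gC mulr_sumr -sumrN /=.
    rewrite [RHS](big_ord_widen (n + d)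
      (fun i => g`_0 * (- (g`_i.+1 / g`_0) * C (n + (d - i.+1))%N))) ?leq_addl //.
    rewrite [RHS]big_mkcond; apply: eq_bigr => i _; rewrite /bump /= add1n.
    case: ltnP => [ltid|ledi].
      by rewrite mulNr mulrN mulrA mulrCA mulfV // mulr1 addnBA.
    rewrite nth_default ?mul0r ?oppr0 // (leq_trans (leqSpred _)) // ltnS.
    by rewrite (leq_trans _ ledi) // leq_maxr.
  by apply: span_sum => i; apply/spanZ/span_gen.
exists 'I_d, w; split; first exact: card_ord.
  move=> i; have := wP i.+1 (ltn_ord i); congr span.
  by apply: funext => n; rewrite addnS.
by have := wP 0%N (leq0n _); congr span; apply: funext => n; rewrite addn0.
Qed.

(** 1 + f/g = (f + g)/g, and this fraction is still reduced. *)
Lemma rational_one_plus C : rational C -> rational (one_plus C).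
Proof.
move=> [f [g [cop g0 Cfg]]]; exists (f + g), g; split=> //.
  by rewrite coprimep_sym addrC -[X in X + _]mul1r coprimep_addl_mul coprimep_sym.
move=> n; rewrite coefD -Cfg addrC.
under eq_bigr => i _ do rewrite mulrDr.
rewrite big_split /=; congr (_ + _).
rewrite big_ord_recr /= subnn mulr1 big1 ?add0r // => i _.
by rewrite subn_eq0 leqNgt ltn_ord mulr0.
Qed.

End RationalNorm.

(** * The bounds for [exp_bang] and [log_bang] *)

Theorem theorem1p5
  (p : nat) (hp : prime p)
  (K : closedFieldType) (iota : {rmorphism 'F_p -> K})
  (hK : integralRange iota)
  (F : finFieldType) (e : nat) (hF : #|F| = (p ^ e)%N)
  (jota : {rmorphism F -> K})
  (A : series K) (hA0 : A 0%N = 0) (hA : rational A)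
  (hAF : forall n : nat, exists x : F, A n = jota x) :
  (rational (exp_bang A) /\
   (series_norm (exp_bang A) <= p ^ (p ^ e) ^ series_norm A)%N) /\
  (rational (log_bang (one_plus A)) /\
   (series_norm (log_bang (one_plus A)) <=
      1 + series_norm (one_plus A) ^ p)%N).
Proof.
have p0 := prime_gt0 hp.
have cp : p \in [pchar K] by rewrite (rmorph_pchar iota) // pchar_Fp.
split.
  have recE := recognizable_exp cp (rational_recognizable hA) (shift_exp_bang A).
  have [|ratE normE] :=
    @recognizable_rational _ (exp_bang A) (p ^ series_norm A).-1.
    by rewrite prednK ?expn_gt0 ?p0.
  split=> //; rewrite prednK ?expn_gt0 ?p0 // in normE.
  (* It remains to compare exponents: [d < q ^ d] for the norm [d] of [A], since [q = #|F|] exceeds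
     1. *)
  apply: leq_trans normE _; rewrite leq_exp2l ?prime_gt1 //.
  by apply/ltnW/ltn_expl; rewrite -hF; exact: card_finNzRing_gt1.
rewrite add1n; apply/recognizable_rational/recognizable_log => //.
  by rewrite /one_plus hA0 addr0.
exact/rational_recognizable/rational_one_plus.
Qed.
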